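(* Let $\Gamma$ be a finitely generated group and $S\subset\Gamma$ a finite generating set. Let $G=\mathrm{Cay}(\Gamma,S)$ be the associated Cayley graph, with its left-multiplication action of $\Gamma$. Let $M$ be a median graph. Then: (i) there is a metrically proper action of $\Gamma$ on $M$ if and only if $G$ admits a $\Gamma$-canonical proper median decomposition over $M$; (ii) there is a metrically proper and cobounded action of $\Gamma$ on $M$ if and only if $G$ admits a $\Gamma$-canonical geometric median decomposition over $M$.
   Context: Graphs are simple, undirected, possibly infinite; $d$ is the path metric and group actions on graphs are by automorphisms. $\mathrm{Cay}(\Gamma,S)$ has vertex set $\Gamma$ and (unoriented) edges joining $g$ and $gs$ for $g\in\Gamma$, $s\in S$, $s\ne1$. $I(u,v)$ is the set of vertices on some geodesic (shortest path) from $u$ to $v$. A median graph is a connected graph in which $I(u,v)\cap I(v,w)\cap I(w,u)$ is a single vertex for all vertices $u,v,w$. A subgraph $C$ is convex if every geodesic with endpoints in $C$ is contained in $C$. A median decomposition of $G$ over a median graph $M$ is a pair $(M,\beta)$ with $\beta:V(M)\to\mathcal P(V(G))$ such that (M1) $\bigcup_u\beta(u)=V(G)$; (M2) every edge of $G$ has both ends in some $\beta(u)$; (M3) for every $v\in V(G)$ the fibre $\beta^{-1}(v)=\{u: v\in\beta(u)\}$ induces a convex subgraph of $M$. If $\Gamma$ acts on $G$, it is $\Gamma$-canonical if $\Gamma$ acts on $M$ with $g\cdot\beta(v)=\beta(g\cdot v)$ for all $v\in V(M)$, $g\in\Gamma$. It has bounded fibres if there is $R\ge0$ with $\operatorname{diam}(\beta^{-1}(x))\le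 R$ for all $x\in V(G)$. It is properly supported if for all $r\ge0$ there is $R\ge0$ such that for all $v\in V(M)$, $\operatorname{diam}\{x\in V(G): d(v,\beta^{-1}(x))\le r\}\le R$. It is quasi-densely supported if there is $R\ge0$ such that for all $v\in V(M)$ there is $u\in V(M)$ with $d(u,v)\le R$ and $\beta(u)\ne\emptyset$. It is proper if it has bounded fibres and is properly supported; geometric if it is proper and quasi-densely supported. An action of $\Gamma$ on $M$ is metrically proper if for every vertex $x_0$ of $M$ and every $R\ge0$ the set $\{g\in\Gamma: d(x_0,g\cdot x_0)\le R\}$ is finite; it is cobounded if there is $R\ge0$ such that for all $x,y\in V(M)$ there is $g\in\Gamma$ with $d(y,g\cdot x)\le R$. *)

(* Defs.v *)
From Stdlib Require List.
From mathcomp Require Import all_boot.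
From mathcomp Require Import boolp classical_sets functions cardinality.

Set Implicit Arguments.
Unset Strict Implicit.
Unset Printing Implicit Defensive.

Local Open Scope group_scope.
Local Open Scope classical_set_scope.

Record sgraph := SGraph {
  vertex :> Type;
  adj : rel vertex;
  adj_sym : symmetric adj;
  adj_irr : irreflexive adj
}.

Section Graphs.
Variable X : sgraph.
Implicit Types (u v w : X) (p : seq X) (A C : set X).

(** The vertices of the walk are those of [u :: p]; its length is [size p]. *)
Definition walk u v p : Prop := path (@adj X) u p /\ last u p = v.

(** The graph with no vertices does not count as connected. *)
Definition connected_graph : Prop :=
  inhabited X /\ forall u v, exists p, walk u v p.

(** The least length of a walk from [u] to [v]. The value is the junk value 0
    when there is no walk; this never happens in a connected graph, see
    [connected_distP]. *)
Definition dist u v : nat :=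
  xget 0%N [set n | (exists2 p, walk u v p & size p = n)
                    /\ forall p, walk u v p -> (n <= size p)%N].

Definition geodesic u v p : Prop := walk u v p /\ size p = dist u v.

Definition interval u v : set X :=
  [set w | exists2 p, geodesic u v p & List.In w (u :: p)].

Definition median_graph : Prop :=
  connected_graph /\
  forall u v w, exists x,
    interval u v `&` interval v w `&` interval w u = [set x].

(** Convexity of the subgraph induced on the vertex set [C]. *)
Definition convex C : Prop :=
  forall u v p, C u -> C v -> geodesic u v p ->
    forall w, List.In w (u :: p) -> C w.

(** diam A <= R; it holds for the empty set. *)
Definition diam_le A (R : nat) : Prop :=
  forall x y, A x -> A y -> (dist x y <= R)%N.

(** d(v, A) <= r. The infimum defining d(v, A) is over natural numbers, so it
    is attained, and it is infinite when [A] is empty. *)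
Definition dist_set_le v A (r : nat) : Prop :=
  exists2 u, A u & (dist v u <= r)%N.

Lemma connected_distP : connected_graph -> forall u v,
  (exists p, geodesic u v p) /\
  forall p, walk u v p -> (dist u v <= size p)%N.
Proof.
move=> [_ cX] u v; have [p0 wp0] := cX u v.
pose P n := `[< exists2 p, walk u v p & size p = n >].
have exP : exists n, P n by exists (size p0); apply/asboolP; exists p0.
suff [[p wp sp] mp] : [set n | (exists2 p, walk u v p & size p = n)
    /\ forall p, walk u v p -> (n <= size p)%N] (dist u v).
  by split=> //; exists p.
apply: xgetPex; case: (ex_minnP exP) => n /asboolP hn mn.
by exists n; split=> // p wp; apply: mn; apply/asboolP; exists p.
Qed.

End Graphs.

Record graph_action (Gamma : groupType) (X : sgraph) := GraphAction {
  act :> Gamma -> X -> X;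
  act1 : forall x, act 1 x = x;
  actM : forall g h x, act (g * h) x = act g (act h x);
  act_adj : forall g x y, adj (act g x) (act g y) = adj x y
}.

Definition metrically_proper (Gamma : groupType) (X : sgraph)
    (a : graph_action Gamma X) : Prop :=
  forall (x0 : X) (R : nat), finite_set [set g | (dist x0 (a g x0) <= R)%N].

Definition cobounded (Gamma : groupType) (X : sgraph)
    (a : graph_action Gamma X) : Prop :=
  exists R : nat, forall x y : X, exists g, (dist y (a g x) <= R)%N.

(** The subgroup generated by [S] is the whole of [Gamma]; [S] is not assumed
    to be closed under inversion. *)
Definition generates (Gamma : groupType) (S : set Gamma) : Prop :=
  smallest [set H : set Gamma | group_closed [in H]] S = [set: Gamma].

Section Cayley.
Variables (Gamma : groupType) (S : set Gamma).

Definition cayley_adj : rel Gamma := fun g h =>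
  `[< exists s, [/\ S s, s <> 1 & h = g * s \/ g = h * s] >].

Lemma cayley_adj_sym : symmetric cayley_adj.
Proof.
by move=> g h; apply/asboolP/asboolP => -[s [Ss s1 e]]; exists s; split=> //;
  case: e; [right|left|right|left].
Qed.

Lemma cayley_adj_irr : irreflexive cayley_adj.
Proof.
move=> g; apply/negP => /asboolP[s [_ s1 e]]; apply: s1.
by apply: (mulgI g); rewrite mulg1; case: e => <-.
Qed.

Definition cayley : sgraph := SGraph cayley_adj_sym cayley_adj_irr.

Lemma cayley_act_adj (g x y : Gamma) :
  cayley_adj (g * x) (g * y) = cayley_adj x y.
Proof.
apply/asboolP/asboolP => -[s [Ss s1 e]]; exists s; split=> //.
  by case: e => e; [left|right]; apply: (mulgI g); rewrite e mulgA.
by case: e => ->; [left|right]; rewrite mulgA.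
Qed.

Definition cayley_action : graph_action Gamma cayley :=
  @GraphAction Gamma cayley (fun g x => g * x)
    (@mul1g Gamma) (fun g h x => esym (mulgA g h x)) cayley_act_adj.

Lemma cayley_connected : generates S -> connected_graph cayley.
Proof.
move=> gS; split; first exact: (inhabits (1 : Gamma)).
pose H : set Gamma := [set h | forall g : Gamma,
  exists p : seq cayley, walk (g : cayley) (g * h) p].
have walkC (u v : cayley) p : walk u v p -> exists q, walk v u q.
  move=> [pp <-]; exists (rev (belast u p)); split.
    rewrite rev_path -(@eq_path _ (@adj cayley)) // => x y.
    exact: cayley_adj_sym.
  by case: p pp => //= y p _; rewrite rev_cons last_rcons.
suff HT h : H h by move=> u v; have := HT (u^-1 * v) u; rewrite mulgA mulgV mul1g.
have : smallest [set H : set Gamma | group_closed [in H]] S h by rewrite gS.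
apply; split.
  split; first by rewrite !inE => g; exists [::]; split; rewrite //= mulg1.
  move=> x y; rewrite !inE => Hx Hy g.
  have [p [pp lp]] := Hx g.
  have [q /walkC[r [pr lr]]] := Hy (g * x / y).
  exists (p ++ r); rewrite mulgA; split.
    by rewrite cat_path pp lp /=; move: pr; rewrite mulgVK.
  by rewrite last_cat lp; move: lr; rewrite mulgVK.
move=> s Ss g; have [->|/eqP s1] := eqVneq s 1.
  by exists [::]; split; rewrite //= mulg1.
exists [:: g * s]; split=> //=; rewrite andbT.
by apply/asboolP; exists s; split=> //; left.
Qed.

End Cayley.

Section Decompositions.
Variables (G M : sgraph) (beta : M -> set G).

Definition fibre (x : G) : set M := [set u | beta u x].

Record median_decomposition : Prop := MedianDecomposition {
  md_median : median_graph M;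
  md_cover : \bigcup_u beta u = [set: G];
  md_edge : forall x y : G, adj x y -> exists u, beta u x /\ beta u y;
  md_convex : forall x : G, convex (fibre x)
}.

(** [Gamma] acts on [G] through [aG]. *)
Definition canonical_decomposition (Gamma : groupType)
    (aG : graph_action Gamma G) : Prop :=
  exists aM : graph_action Gamma M,
    forall (g : Gamma) (v : M), aG g @` beta v = beta (aM g v).

Definition bounded_fibres : Prop :=
  exists R : nat, forall x : G, diam_le (fibre x) R.

Definition properly_supported : Prop :=
  forall r : nat, exists R : nat, forall v : M,
    diam_le [set x : G | dist_set_le v (fibre x) r] R.

Definition quasi_densely_supported : Prop :=
  exists R : nat, forall v : M, exists u : M,
    (dist u v <= R)%N /\ beta u !=set0.

Definition proper_decomposition : Prop :=
  bounded_fibres /\ properly_supported.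

Definition geometric_decomposition : Prop :=
  proper_decomposition /\ quasi_densely_supported.

End Decompositions.

(* Main.v *)
(** Fix a base vertex x0 of M. Given a metrically proper action, take a bounded
    convex set C containing x0 and all s x0 with s in S, and let the fibre of g
    be gC: the edge (g, gs) is covered by g s x0, and two fibres that are both
    within r of v force g x0 and h x0 to be close, hence g^-1 h to lie in a
    finite set. Conversely, the elements moving x0 by at most R all have a fibre
    within a uniform distance of x0, so they form a bounded, hence finite, subset
    of the Cayley graph.

    The bounded set C is obtained by adding points one at a time: in a median
    graph the join of a point x with a convex set C, i.e. the union of the
    intervals from x to the points of C, is again convex. Being star-shaped
    around x, it is convex as soon as it is locally convex, and local convexity
    follows by comparing the gates in C of adjacent vertices. *)
Require Import Defs.
From Stdlib Require List.
From mathcomp Require Import all_boot.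
From mathcomp Require Import boolp classical_sets functions cardinality.
From mathcomp Require Import zify.

Set Implicit Arguments.
Unset Strict Implicit.
Unset Printing Implicit Defensive.

Local Open Scope classical_set_scope.

(** * Path metric of a connected graph: betweenness and walks inside a set *)

Section PathMetric.
Variable X : sgraph.
Hypothesis cX : connected_graph X.
Implicit Types (u v w x y z : X) (C : set X).

Lemma dist_le_walk u v p : walk u v p -> dist u v <= size p.
Proof. by have [_] := connected_distP cX u v; apply. Qed.

Lemma geodesic_exists u v : exists p, geodesic u v p.
Proof. by have [] := connected_distP cX u v. Qed.

Lemma walk_cat u v w p q : walk u v p -> walk v w q -> walk u w (p ++ q).
Proof. by move=> [pp <-] [pq <-]; split; rewrite ?cat_path ?last_cat ?pp. Qed.

Lemma walk_rev u v p : walk u v p -> exists2 q, walk v u q & size q = size p.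
Proof.
move=> [pp <-]; exists (rev (belast u p)); last by rewrite size_rev size_belast.
split.
  rewrite rev_path -(@eq_path _ (@adj X)) // => x y; exact: adj_sym.
by case: p pp => //= y p _; rewrite rev_cons last_rcons.
Qed.

Lemma dist_triangle v u w : dist u w <= dist u v + dist v w.
Proof.
have [[p [wp <-]] [q [wq <-]]] := (geodesic_exists u v, geodesic_exists v w).
by rewrite -size_cat; apply/dist_le_walk/(walk_cat wp wq).
Qed.

Lemma dist_sym u v : dist u v = dist v u.
Proof.
have le x y : dist x y <= dist y x.
  have [p [wp <-]] := geodesic_exists y x.
  by have [q wq <-] := walk_rev wp; apply: dist_le_walk.
by apply/eqP; rewrite eqn_leq !le.
Qed.

Lemma dist_refl u : dist u u = 0.
Proof. by apply/eqP; rewrite -leqn0; apply: (@dist_le_walk u u [::]). Qed.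

Lemma dist_eq0 u v : dist u v = 0 -> u = v.
Proof. by have [[|? ?] [[_ <-] <-]] := geodesic_exists u v. Qed.

Lemma dist_adj_le u v : adj u v -> dist u v <= 1.
Proof. by move=> uv; apply: (@dist_le_walk u v [:: v]); split; rewrite //= uv. Qed.

Lemma dist1_adj u v : dist u v = 1 -> adj u v.
Proof.
have [[|? [|? ?]] [[/= + <-] <-]] // := geodesic_exists u v.
by case/andP.
Qed.

Lemma dist_pred u v n : dist u v = n.+1 -> exists2 w, adj w v & dist u w = n.
Proof.
move=> duv; have [p [[pp lp]]] := geodesic_exists u v; rewrite duv.
case/lastP: p pp lp => // p z; rewrite rcons_path last_rcons size_rcons.
move=> /andP[pp az] zv [sp]; rewrite zv in az; exists (last u p) => //.
have : dist u (last u p) <= n by rewrite -sp; apply: dist_le_walk.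
have := dist_triangle (last u p) u v; have := dist_adj_le az; lia.
Qed.

Lemma dist_adj_diff u v w : adj v w ->
  dist u v <= (dist u w).+1 /\ dist u w <= (dist u v).+1.
Proof.
move=> /dist_adj_le vw; have := dist_triangle v u w.
by have := dist_triangle w u v; rewrite (dist_sym w v); lia.
Qed.

(** The metric form of [interval u v w]; it turns arguments about geodesics into linear arithmetic
    on distances. *)
Definition btw u w v := dist u w + dist w v = dist u v.

Lemma btw_sym u w v : btw u w v -> btw v w u.
Proof. by rewrite /btw (dist_sym v w) (dist_sym w u) (dist_sym v u) addnC. Qed.

Lemma btw_left u v : btw u u v.
Proof. by rewrite /btw dist_refl. Qed.

Lemma btw_right u v : btw u v v.
Proof. by rewrite /btw dist_refl addn0. Qed.

Lemma btw_trans u w v z : btw u w v -> btw u z w -> btw u z v.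
Proof.
rewrite /btw => uwv uzw; have := dist_triangle w z v.
by have := dist_triangle z u v; lia.
Qed.

Lemma geodesic_btw u v p w : geodesic u v p -> List.In w (u :: p) -> btw u w v.
Proof.
move=> [[pp lp] sp] inw; have [l1 [l2]] := List.in_split _ _ inw.
case: l1 => [[<- _]|_ l1 [_ e]]; first exact: btw_left.
have {}e : p = rcons l1 w ++ l2 by rewrite cat_rcons.
move: pp lp sp; rewrite e cat_path last_cat last_rcons size_cat.
move=> /andP[p1 p2] l2v sp.
have : dist u w <= size (rcons l1 w).
  by apply: dist_le_walk; split=> //; rewrite last_rcons.
have : dist w v <= size l2 by apply: dist_le_walk.
by have := dist_triangle w u v; rewrite /btw; lia.
Qed.

Lemma btw_geodesic u v w : btw u w v ->
  exists2 p, geodesic u v p & List.In w (u :: p).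
Proof.
have [[p [wp sp]] [q [wq sq]]] := (geodesic_exists u w, geodesic_exists w v).
move=> uwv; exists (p ++ q).
  by split; [apply: walk_cat wp wq | rewrite size_cat sp sq].
case: wp => _ <-; elim: p u {sp uwv} => [|x p IH] u /=; first by left.
by right; apply: IH.
Qed.

Lemma intervalP u v w : interval u v w <-> btw u w v.
Proof.
by split=> [[p gp wp]|/btw_geodesic//]; apply: geodesic_btw gp wp.
Qed.

Lemma convexP C :
  convex C <-> forall u v w, C u -> C v -> btw u w v -> C w.
Proof.
split=> [cC u v w Cu Cv /btw_geodesic[p gp wp]|cC u v p Cu Cv gp w wp].
  exact: cC gp w wp.
exact: cC (geodesic_btw gp wp).
Qed.

(** Every vertex but the last must lie in [C]. The recursion is at the end [v] because the convexity
    argument peels off the last step. *)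
Fixpoint chain C n u v : Prop :=
  if n is m.+1 then exists w, [/\ C w, chain C m u w & adj w v] else u = v.

Lemma chain_cat C m n u v w :
  chain C m u v -> chain C n v w -> chain C (n + m) u w.
Proof.
move=> uv; elim: n w => [w <- //|n IH w [z [Cz vz zw]]].
by exists z; split=> //; apply: IH.
Qed.

Lemma dist_le_chain C n u v : chain C n u v -> dist u v <= n.
Proof.
elim: n v => [v <-|n IH v [w [_ /IH le]]]; first by rewrite dist_refl.
by move=> /(dist_adj_diff u); lia.
Qed.

Lemma interval_chain C u v :
  (forall w, btw u w v -> C w) -> chain C (dist u v) u v.
Proof.
move duv: (dist u v) => n.
elim: n v duv => [v /dist_eq0 //|n IH v duv sC].
have [w wv uw] := dist_pred duv.
have uwv : btw u w v.
  by have := dist_triangle w u v; have := dist_adj_le wv; rewrite /btw; lia.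
exists w; split=> //; first exact: sC.
by apply: IH => // z /(btw_trans uwv); apply: sC.
Qed.

End PathMetric.

(** * Median graphs: convexity from local conditions, gates and joins *)

Section Median.
Variable M : sgraph.
Hypothesis medM : median_graph M.
Let cM : connected_graph M := proj1 medM.
Implicit Types (u v w x y z c : M) (C : set M).

Lemma median_exists u v w : exists x, [/\ btw u x v, btw v x w & btw w x u].
Proof.
have [x ex] := proj2 medM u v w; exists x.
have : [set x] x by [].
by rewrite -ex => -[[/(intervalP cM) ? /(intervalP cM) ?] /(intervalP cM) ?].
Qed.

Lemma median_unique u v w x y :
  btw u x v -> btw v x w -> btw w x u ->
  btw u y v -> btw v y w -> btw w y u -> x = y.
Proof.
have [z ez] := proj2 medM u v w.
have eqz t : btw u t v -> btw v t w -> btw w t u -> t = z.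
  by move=> ? ? ?; suff : [set z] t by []; rewrite -ez; split; [split|];
    apply/(intervalP cM).
by move=> ? ? ? ? ? ?; rewrite (eqz x) // (eqz y).
Qed.

(** Parity: the three distances between [u], [v], [w] sum to twice the total distance to their
    median, while equality here would make that sum odd. *)
Lemma median_bipartite u v w : adj v w -> dist u v <> dist u w.
Proof.
move=> vw; have [x] := median_exists u v w.
have := dist_adj_le cM vw; rewrite /btw (dist_sym cM w x) (dist_sym cM x u).
case dvw: (dist v w) => [|[|//]] _; last by rewrite (dist_sym cM v x) (dist_sym cM w u) => -[]; lia.
by move: vw; rewrite (dist_eq0 cM dvw) adj_irr.
Qed.

Lemma dist_adj u v w : adj v w ->
  dist u v = (dist u w).+1 \/ dist u w = (dist u v).+1.
Proof.
move=> vw; have := median_bipartite (u := u) vw.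
by have := dist_adj_diff cM u vw; lia.
Qed.

(** The median of [u], [y], [z] is equidistant from [y] and [z], since these are equally far from
    [u]; as [dist y z] is positive and at most 2, both distances are 1. *)
Lemma quadrangle u v y z : adj v y -> adj v z -> y <> z ->
  dist u v = (dist u y).+1 -> dist u v = (dist u z).+1 ->
  exists x, [/\ adj x y, adj x z & dist u y = (dist u x).+1].
Proof.
move=> vy vz yz uy uz; have [x] := median_exists u y z.
rewrite /btw (dist_sym cM z x) (dist_sym cM x u) (dist_sym cM y x) (dist_sym cM z u).
move=> [h1 h2 h3].
have := dist_triangle cM v y z; have := dist_adj_le cM vy; have := dist_adj_le cM vz.
rewrite (dist_sym cM y v) => *.
have yz0 : dist y z <> 0 by move/(dist_eq0 cM).
have xy : dist x y = 1 by lia.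
have xz : dist x z = 1 by lia.
by exists x; split; [apply: (dist1_adj cM)|apply: (dist1_adj cM)|lia].
Qed.

(* Induction on the length of a path from [u] to [v] inside [C]: the quadrangle
   condition moves the last step of that path to any other last step of a
   geodesic. *)
Lemma local_convex_chain C :
  (forall y z w, C y -> C z -> y <> z -> adj w y -> adj w z -> C w) ->
  forall n u v, C u -> C v -> chain C n u v -> forall w, btw u w v -> C w.
Proof.
move=> locC n; elim/ltn_ind: n => -[_ u v Cu _ <- w|n IH u v Cu Cv].
  rewrite /btw (dist_refl cM) => d0.
  by have -> : w = u by apply/(dist_eq0 cM); lia.
move=> [p [Cp up pv]].
have {}IHp w : btw u w p -> C w by apply: IH up w.
have [duv|duv] := dist_adj u pv => w uwv.
  apply: IHp; have := dist_triangle cM w u p.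
  by have := dist_adj_diff cM w pv; move: uwv; rewrite /btw; lia.
case dwv: (dist w v) => [|k]; first by rewrite (dist_eq0 cM dwv).
have [q qv wq] := dist_pred cM dwv.
have uwq : btw u w q.
  have := dist_triangle cM w u q; have := dist_adj_diff cM u qv.
  by move: uwv; rewrite /btw; lia.
have [e|qp] := pselect (q = p); first by apply: IHp; rewrite -e.
have duq : dist u v = (dist u q).+1 by move: uwv uwq; rewrite /btw; lia.
rewrite adj_sym in qv; have vp := pv; rewrite adj_sym in vp.
have [x [xq xp dux]] := quadrangle qv vp qp duq duv.
have uxp : btw u x p.
  by have := dist_triangle cM x u p; have := dist_adj_le cM xp; rewrite /btw; lia.
have Cx : C x by apply: IHp.
have Cq : C q.
  apply: (locC x v) => //; last 2 first; rewrite 1?adj_sym //.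
  by move=> xv; move: duq; rewrite -xv; lia.
have ch : chain C (dist u x).+1 u q.
  exists x; split=> //; apply: (interval_chain cM) => z /(btw_trans cM uxp).
  exact: IHp.
apply: (IH _ _ u q _ _ ch) (uwq) => //.
by have := dist_le_chain cM up; lia.
Qed.

(** Any two points of [C] are joined by a chain inside [C] passing through [x], so
    [local_convex_chain] applies. *)
Lemma star_local_convex C x : C x ->
  (forall y w, C y -> btw x w y -> C w) ->
  (forall y z w, C y -> C z -> y <> z -> adj w y -> adj w z -> C w) ->
  convex C.
Proof.
move=> Cx starC locC; apply/(convexP cM) => u v w Cu Cv.
apply: (local_convex_chain locC Cu Cv).
apply: (@chain_cat _ _ (dist u x) (dist x v) _ x).
  by apply: (interval_chain cM) => z /(btw_sym cM); apply: starC.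
by apply: (interval_chain cM) => z; apply: starC.
Qed.

(* If [w] is farther than [y] and [z] from both [x] and [c], then [y] and [z] are
   both medians of [x], [c], [w]. *)
Lemma common_neighbour_closer x c w y z : y <> z -> adj w y -> adj w z ->
  btw x y c -> btw x z c -> btw x w c.
Proof.
move=> yz wy wz xyc xzc.
have tr := dist_triangle cM w x c.
have clo t : adj w t -> btw x t c -> btw x w c \/ btw x t w /\ btw c t w.
  move=> wt; have := dist_adj x wt; have := dist_adj c wt.
  have := dist_adj_le cM wt; have := dist_triangle cM t x w.
  have := dist_triangle cM t c w; rewrite /btw (dist_sym cM w t).
  by rewrite (dist_sym cM t c) (dist_sym cM w c) in tr *; lia.
case: (clo _ wy xyc) => // -[xyw cyw]; case: (clo _ wz xzc) => // -[xzw czw].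
case: yz; apply: (@median_unique x c w); do ?by [].
  exact: (btw_sym cM).
exact: (btw_sym cM).
Qed.

Lemma interval_convex u v : convex [set w | btw u w v].
Proof.
apply: (@star_local_convex _ u) => [|y w /= |y z w /= uyv uzv yz wy wz].
- exact: btw_left.
- exact: btw_trans.
exact: common_neighbour_closer yz wy wz uyv uzv.
Qed.

(** Take [c] in [C] nearest to [x]. The median of [x], [c], [c'] is in [C] by convexity and lies
    between [x] and [c], so it is [c]. *)
Lemma gate_exists C x : convex C -> C !=set0 ->
  exists2 c, C c & forall c', C c' -> btw x c c'.
Proof.
move=> /(convexP cM) cC [c0 Cc0].
pose P n := `[< exists2 c, C c & dist x c = n >].
have exP : exists n, P n by exists (dist x c0); apply/asboolP; exists c0.
case: (ex_minnP exP) => _ /asboolP[c Cc <-] mn; exists c => // c' Cc'.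
have [m [xmc cmc' c'mx]] := median_exists x c c'.
have /mn le : P (dist x m) by apply/asboolP; exists m => //; apply: cC cmc'.
have mc : m = c by apply: (dist_eq0 cM); move: xmc le; rewrite /btw; lia.
by rewrite -mc; apply: (btw_sym cM).
Qed.

Definition join x C : set M := [set w | exists2 c, C c & btw x w c].

Lemma join_convex x C : convex C -> C !=set0 -> convex (join x C).
Proof.
move=> cC C0; have [c0 Cc0] := C0.
apply: (@star_local_convex _ x) => [|y w [c Cc xyc] xwy|y z w [c1 Cc1 y1] [c2 Cc2 z2]].
- by exists c0 => //; apply: btw_left.
- by exists c => //; apply: btw_trans xyc xwy.
move=> yz wy wz; have [p Cp gp] := gate_exists w cC C0.
(* If neither neighbour of [w] settles the claim, both lie between [x] and the gate [p] of [w], and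
   hence so does [w]. *)
suff key t c1' : C c1' -> btw x t c1' -> adj w t -> join x C w \/ btw x t p.
  have [//|xyp] := key y c1 Cc1 y1 wy; have [//|xzp] := key z c2 Cc2 z2 wz.
  by exists p => //; apply: common_neighbour_closer yz wy wz xyp xzp.
move=> {y z c1 c2 Cc1 y1 Cc2 z2 yz wy wz c0 Cc0} Cc1' xtc1' wt.
have [c Cc gc] := gate_exists t cC C0.
(* The endpoint in [C] may be replaced by the gate [c] of [t]. *)
have xtc : btw x t c.
  have := gc _ Cc1'; move: xtc1'; rewrite /btw.
  by have := dist_triangle cM c x c1'; have := dist_triangle cM t x c; lia.
have tcp := gc _ Cp; have wpc := gp _ Cc.
have [ecp|cp] := pselect (c = p); first by right; rewrite -ecp.
have cp0 : dist c p <> 0 by move/(dist_eq0 cM).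
left.
have dxw := dist_adj x wt; have dcw := dist_adj c wt.
have dtw := dist_adj_le cM wt; have tri := dist_triangle cM w t p.
move: (tcp) (wpc) (xtc); rewrite /btw => etcp ewpc extc.
rewrite (dist_sym cM c w) (dist_sym cM c t) in dcw.
rewrite (dist_sym cM p c) in ewpc; rewrite (dist_sym cM t w) in tri.
have xwt_done : btw x w t -> join x C w.
  by move=> xwt; exists c => //; apply: btw_trans xtc xwt.
have twc_done : dist t c = (dist w c).+1 -> join x C w.
  move=> tc; exists c => //; apply: (btw_sym cM).
  apply: (btw_trans cM (btw_sym cM xtc)); apply: (btw_sym cM).
  by rewrite /btw (dist_sym cM t w); have := dist_triangle cM w t c;
    rewrite (dist_sym cM t w); lia.
have [//|wc] : join x C w \/ dist w c = (dist t c).+1 by case: dcw; auto.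
have [//|xw] : join x C w \/ dist x w = (dist x t).+1.
  case: dxw => [|xt]; first by auto.
  by left; apply: xwt_done; have := dist_triangle cM w x t; rewrite /btw; lia.
(* Now [w] is one step farther than [t] from both [x] and [c]. The two gate equations then give
   [2 * dist c p <= 2], and also [dist w p = dist t c], so [w] lies between [t] and [p]. *)
have cp1 : dist c p = 1 by lia.
(* If [p] is nearer to [x] than [c], both [t] and [p] are in the convex interval from [x] to [c],
   hence so is [w]; otherwise [w] lies between [x] and [p]. *)
have [xp|xc] := dist_adj x (dist1_adj cM cp1).
  exists c => //; have /(convexP cM) cI := @interval_convex x c.
  apply: (cI t p) => //=.
    by rewrite /btw (dist_sym cM p c); lia.
  by rewrite /btw (dist_sym cM t w); lia.
by exists p => //; rewrite /btw; lia.
Qed.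

Lemma bounded_convex_cover (s : seq M) (x0 : M) :
  exists C, [/\ convex C, C x0, forall x, List.In x s -> C x
    & exists R, forall y, C y -> dist x0 y <= R].
Proof.
elim: s => [|x s [C [cC C0 Cs [R CR]]]].
  exists [set w | btw x0 w x0]; split=> //; first exact: interval_convex.
    exact: btw_left.
  by exists 0 => y /=; rewrite /btw (dist_refl cM); lia.
have sub : C `<=` join x C by move=> c Cc; exists c => //; apply: btw_right.
exists (join x C); split.
- by apply: join_convex => //; exists x0.
- exact: sub.
- move=> y [<-|/Cs /sub //]; exists x0 => //; exact: btw_left.
(* A point between [x] and [c] is within [dist x c <= dist x x0 + R] of [x]. *)
exists (dist x0 x + dist x x0 + R) => y [c /CR x0c].
have := dist_triangle cM x x0 y; have := dist_triangle cM x0 x c.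
by rewrite /btw; lia.
Qed.

End Median.

(** * Group actions by isometries *)

Lemma dist_act (Gamma : groupType) (X : sgraph) (a : graph_action Gamma X) :
  connected_graph X -> forall g x y, dist (a g x) (a g y) = dist x y.
Proof.
move=> cX.
have le g x y : dist (a g x) (a g y) <= dist x y.
  have [p [[pp <-] <-]] := geodesic_exists cX x y.
  rewrite -(size_map (a g)); apply: dist_le_walk => //.
  split; last by rewrite last_map.
  by rewrite path_map -(@eq_path _ (@adj X)) // => ? ? /=; rewrite act_adj.
move=> g x y; apply/eqP; rewrite eqn_leq le /=.
have := le g^-1%g (a g x) (a g y).
by rewrite -!actM mulVg !act1.
Qed.

Lemma actK (Gamma : groupType) (X : sgraph) (a : graph_action Gamma X) g x :
  a g^-1%g (a g x) = x.
Proof. by rewrite -actM mulVg act1. Qed.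

Lemma actVK (Gamma : groupType) (X : sgraph) (a : graph_action Gamma X) g x :
  a g (a g^-1%g x) = x.
Proof. by rewrite -actM mulgV act1. Qed.

Lemma act_convex (Gamma : groupType) (X : sgraph) (a : graph_action Gamma X) :
  connected_graph X ->
  forall g (C : set X), convex C -> convex [set x | C (a g x)].
Proof.
move=> cX g C /(convexP cX) cC; apply/(convexP cX) => u v w Cu Cv uwv.
by apply: cC Cu Cv _; rewrite /btw !dist_act.
Qed.

Lemma finite_set_bounded (T : choiceType) (A : set T) (f : T -> nat) :
  finite_set A -> exists R, forall x, A x -> f x <= R.
Proof.
move=> /finite_seqP[s ->]; exists (\max_(x <- s) f x) => x /= xs.
exact: leq_bigmax_seq.
Qed.

(** * Finiteness of balls in the Cayley graph *)

Section CayleyBalls.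
Variables (Gamma : groupType) (S : set Gamma).
Hypotheses (finS : finite_set S) (genS : generates S).
Let cG := cayley_connected genS.

Lemma cayley_dist_mul (g x y : cayley S) :
  dist ((g * x)%g : cayley S) ((g * y)%g : cayley S) = dist x y.
Proof. exact: (dist_act (cayley_action S) cG). Qed.

(** The next ball is covered by the previous one and its right translates by each [s] and [s^-1];
    both occur because edges are unoriented. *)
Lemma cayley_ball_finite (g : cayley S) R :
  finite_set [set h : cayley S | dist g h <= R].
Proof.
elim: R => [|R IH].
  apply: (@sub_finite_set _ _ [set g]); last exact: finite_set1.
  by move=> h /=; rewrite leqn0 => /eqP /(dist_eq0 cG).
apply: (@sub_finite_set _ _ ([set h : cayley S | dist g h <= R] `|`
  \bigcup_(s in S) ((fun h : Gamma => h * s)%g @` [set h : cayley S | dist g h <= R] `|`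
    (fun h : Gamma => h * s^-1)%g @` [set h : cayley S | dist g h <= R]))).
  move=> h /=; case: (ltngtP (dist g h) R.+1) => // [le _|e _]; first by left.
  right; have [w wh gw] := dist_pred cG e.
  move/asboolP: wh => [s [Ss _ ws]]; exists s => //.
  case: ws => ws; [left|right]; exists w; rewrite /= ?gw //.
  by rewrite ws mulgK.
rewrite finite_setU; split=> //; apply: bigcup_finite => // s _.
by rewrite finite_setU; split; apply: finite_image.
Qed.

End CayleyBalls.

(** * Passing between actions and canonical decompositions *)

Section Correspondence.
Variables (Gamma : groupType) (S : set Gamma) (M : sgraph).
Hypotheses (finS : finite_set S) (genS : generates S) (medM : median_graph M).
Let cM : connected_graph M := proj1 medM.
Let cG := cayley_connected genS.
Implicit Types (a : graph_action Gamma M) (beta : M -> set (cayley S)).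

(** The last clause is an implication so that one construction serves both equivalences. *)
Lemma metrically_proper_decomposition a : metrically_proper a ->
  exists beta, [/\ median_decomposition beta,
    canonical_decomposition beta (cayley_action S), proper_decomposition beta
    & cobounded a -> quasi_densely_supported beta].
Proof.
move=> propa; have [x0] := proj1 cM.
have /finite_seqP[s Ss] := finS.
have [C [cC C0 Cs [R CR]]] := bounded_convex_cover medM (map (a^~ x0) s) x0.
pose beta (v : M) : set (cayley S) := [set g : Gamma | C (a g^-1%g v)].
have betaE g : beta (a g x0) g by rewrite /beta /= actK.
have CS t : S t -> C (a t x0).
  rewrite Ss /= => ts; apply: Cs; elim: s ts {Ss} => //= y s IH.
  by rewrite in_cons => /orP[/eqP ->|/IH]; [left|right].
have dC g u : beta u g -> dist (a g x0) u <= R.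
  by move=> /CR; rewrite -(dist_act a cM g) actVK.
exists beta; split.
- split=> //.
  + by apply/seteqP; split=> // g _; exists (a g x0).
  + have edge (x : Gamma) t : S t -> beta (a (x * t)%g x0) x.
      by move=> St; rewrite /beta /= actM actK; apply: CS.
    move=> x y /asboolP[t [St _ [e|e]]]; [exists (a y x0)|exists (a x x0)].
      by split=> //; rewrite e; apply: edge.
    by split=> //; rewrite e; apply: edge.
  + by move=> g; apply: (act_convex (a := a)).
- exists a => g v; apply/seteqP; split=> [h [k kv <-]|h hv] /=.
    by rewrite /beta /= invgM actM actK.
  exists (g^-1 * h)%g; last by rewrite /= mulVKg.
  by rewrite /beta /= invgM invgK actM.
- split.
    exists (R + R) => g u v /dC du /dC dv.
    have := dist_triangle cM (a g x0) u v.
    by rewrite (dist_sym cM u (a g x0)); lia.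
  move=> r.
  (* If the fibres of [g] and [h] come within [r] of [v], then [a g x0] and [a h x0] are each within
     [r + R] of [v]. *)
  have [K HK] := finite_set_bounded (fun g : Gamma => dist (1%g : cayley S) g)
    (propa x0 (2 * (r + R))).
  exists K => v g h [u /dC du vu] [w /dC dw vw].
  rewrite -(cayley_dist_mul genS g^-1%g) mulVg; apply: HK => /=.
  rewrite actM -(dist_act a cM g) actVK.
  have := dist_triangle cM u (a g x0) v; have := dist_triangle cM v (a g x0) (a h x0).
  have := dist_triangle cM w v (a h x0).
  by rewrite (dist_sym cM u v) (dist_sym cM w (a h x0)); lia.
move=> [K HK]; exists K => v; have [g vg] := HK x0 v.
by exists (a g x0); split; [rewrite (dist_sym cM)|exists g].
Qed.

Lemma proper_decomposition_action beta :
  median_decomposition beta -> canonical_decomposition beta (cayley_action S) ->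
  proper_decomposition beta ->
  exists a, metrically_proper a /\ (quasi_densely_supported beta -> cobounded a).
Proof.
move=> [_ cov _ _] [a can] [[D HD] supp]; exists a.
have betaM (g h : Gamma) v : beta v h -> beta (a g v) (g * h)%g.
  by rewrite -can => ?; exists h.
split=> [x0 R|[K HK]].
  have [c _ c1] : (\bigcup_u beta u) (1%g : Gamma) by rewrite cov.
  (* If [g] moves [x0] by at most [R], the vertex [a g c] of the fibre of [g] is within
     [R + dist x0 c] of [x0]. So [1] and [g] both lie in a set of diameter at most [B]. *)
  have [B HB] := supp (R + dist x0 c).
  apply: sub_finite_set (cayley_ball_finite finS genS (1%g : Gamma) B) => g /= x0g.
  apply: (HB x0); first by exists c => //=; lia.
  exists (a g c); first by have := betaM g _ _ c1; rewrite mulg1.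
  have := dist_triangle cM (a g x0) x0 (a g c).
  by rewrite (dist_act a cM); lia.
(* Go from [y] to a supported [w], cross the fibre of [h], which contains [w] and the translate of
   [u], then go to the translate of [x]. *)
exists (K + (D + K)) => x y.
have [u [ux [g ug]]] := HK x; have [w [wy [h wh]]] := HK y.
exists (h * g^-1)%g.
have := HD h w (a (h * g^-1)%g u) wh.
have := betaM (h * g^-1)%g _ _ ug; rewrite mulgVK => hu /(_ hu).
have := dist_triangle cM w y (a (h * g^-1)%g x).
have := dist_triangle cM (a (h * g^-1)%g u) w (a (h * g^-1)%g x).
by rewrite (dist_act a cM) (dist_sym cM y w); lia.
Qed.

End Correspondence.

Theorem theorem1p5 (Gamma : groupType) (S : set Gamma)
    (finS : finite_set S) (genS : generates S)
    (M : sgraph) (medM : median_graph M) :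
  ((exists a : graph_action Gamma M, metrically_proper a)
   <->
   (exists beta : M -> set (cayley S),
      [/\ median_decomposition beta,
          canonical_decomposition beta (cayley_action S)
        & proper_decomposition beta]))
  /\
  ((exists a : graph_action Gamma M, metrically_proper a /\ cobounded a)
   <->
   (exists beta : M -> set (cayley S),
      [/\ median_decomposition beta,
          canonical_decomposition beta (cayley_action S)
        & geometric_decomposition beta])).
Proof.
have fwd := @metrically_proper_decomposition Gamma S M finS genS medM.
have bwd := @proper_decomposition_action Gamma S M finS genS medM.
split; split.
- by move=> [a /fwd[beta [? ? ? _]]]; exists beta.
- by move=> [beta [/bwd h /h{}h /h[a [? _]]]]; exists a.
- by move=> [a [/fwd[beta [? ? ? qd]] /qd ?]]; exists beta.
by move=> [beta [/bwd h /h{}h [/h[a [? cob]] /cob ?]]]; exists a.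
Qed.
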